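(* There exists a set $\mathcal{A}=\{A_1,\dots,A_7\}\subseteq\mathbb{S}^6$ such that $A_1$ is invertible, $A_1^{-1}\mathcal{A}=\{A_1^{-1}A_i : i=1,\dots,7\}$ is a set of (pairwise) commuting matrices with real eigenvalues, and $\mathcal{A}$ is not ASDC.
   Context: $\mathbb{S}^n$ denotes the real vector space of $n\times n$ real symmetric matrices. A set $\mathcal{A}\subseteq\mathbb{S}^n$ is simultaneously diagonalizable via congruence (SDC) if there exists an invertible $P\in\mathbb{R}^{n\times n}$ such that $P^\top A P$ is diagonal for all $A\in\mathcal{A}$. A set $\mathcal{A}\subseteq\mathbb{S}^n$ is almost simultaneously diagonalizable via congruence (ASDC) if there exist sequences $A_i\to A$ in $\mathbb{S}^n$, one for every $A\in\mathcal{A}$, such that for every $i\in\mathbb{N}$ the set $\{A_i : A\in\mathcal{A}\}$ is SDC. *)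

(* Defs.v *)
From HB Require Import structures.
From mathcomp Require Import all_boot all_order all_algebra.
From mathcomp Require Import all_classical all_reals all_analysis.
From mathcomp Require Import complex.

Set Implicit Arguments.
Unset Strict Implicit.
Unset Printing Implicit Defensive.

Import Order.TTheory GRing.Theory Num.Theory.
Import numFieldNormedType.Exports.

Local Open Scope classical_set_scope.
Local Open Scope ring_scope.
Local Open Scope complex_scope.

Definition symmx (R : realType) (n : nat) : set 'M[R]_n :=
  [set M | M^T = M].

Definition SDC (R : realType) (n : nat) (A : set 'M[R]_n) : Prop :=
  exists2 P : 'M[R]_n, P \in unitmx &
    forall M, A M -> is_diag_mx (P^T *m M *m P).

(* [s M] is the approximating sequence of [M]; only its values at [M] in [A]
   matter.  Convergence is in the entrywise topology of ['M[R]_n]. *)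
Definition ASDC (R : realType) (n : nat) (A : set 'M[R]_n) : Prop :=
  exists s : 'M[R]_n -> nat -> 'M[R]_n,
    (forall M, A M ->
       (forall i, symmx (s M i)) /\ s M i @[i --> \oo] --> M) /\
    forall i, SDC [set s M i | M in A].

(* All the complex eigenvalues of [M] are real; eigenvalues in [R] alone
   would make this vacuous. *)
Definition real_eigenvalues (R : realType) (n : nat) (M : 'M[R]_n) : Prop :=
  forall z : R[i], eigenvalue (map_mx (real_complex R) M) z ->
    z \is Num.real.

(* Main.v *)
Require Import Defs.
From HB Require Import structures.
From mathcomp Require Import all_boot all_order all_algebra.
From mathcomp Require Import all_classical all_reals all_analysis.
From mathcomp Require Import complex.

Set Implicit Arguments.
Unset Strict Implicit.
Unset Printing Implicit Defensive.

Import Order.TTheory GRing.Theory Num.Theory.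
Import numFieldNormedType.Exports.

Local Open Scope classical_set_scope.
Local Open Scope ring_scope.

(** The obstruction is a dimension count.  Congruence by an invertible matrix
    preserves linear dependence and the diagonal matrices of order [n] form a
    space of dimension [n], so an SDC family spans at most [n] dimensions
    ([SDC_span_rank]).  Linear independence is an open condition, so a linearly
    independent family that is a limit of SDC families is itself limited to [n]
    members ([ASDC_independent_leq]).

    It remains to find seven linearly independent symmetric matrices of order 6
    with commuting, real-spectrum quotients.  A large commutative matrix algebra
    is given by Schur's construction: the matrices [[a I, S], [0, a I]] with [a]
    a scalar and [S] any block of order 3 all commute and have [a] as their only
    eigenvalue.  Left multiplication by the block exchange [[0, I], [I, 0]] turns
    them into [[0, a I], [a I, S]], which is symmetric as soon as [S] is.
    Symmetric [S] of order 3 account for 6 dimensions and [a] for one more, so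
    this space has dimension 7 > 6; [schur_form] is a basis of it that starts
    with the block exchange. *)

(** The diagonal entries of [P^T *m B j *m P] are the coordinates of
    [B j] on the [n] rank-one matrices [P^-T *m delta_mx l l *m P^-1]; the matrix
    of the family therefore factors through dimension [n]. *)
Lemma SDC_span_rank (R : realType) (m n : nat) (B : 'I_m -> 'M[R]_n) :
  SDC (range B) -> (\rank (\matrix_j mxvec (B j)) <= n)%N.
Proof.
case=> P uP diagP; set Q := invmx P.
pose D := \matrix_(j, l) (P^T *m B j *m P) l l.
pose W := \matrix_l mxvec (Q^T *m delta_mx l l *m Q).
suff -> : \matrix_j mxvec (B j) = D *m W.
  exact: leq_trans (mxrankM_maxl _ _) (rank_leq_col _).
apply/row_matrixP => j; rewrite rowK row_mul mulmx_sum_row.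
have -> : B j = Q^T *m (P^T *m B j *m P) *m Q.
  by rewrite -!mulmxA mulmxV // mulmx1 mulmxA -trmx_mul mulmxV // trmx1 mul1mx.
have /diagP/is_diag_mxP diagj : range B (B j) by exists j.
have -> : P^T *m B j *m P = \sum_l D j l *: delta_mx l l.
  apply/matrixP => a b; rewrite summxE (bigD1 a) //= big1 => [|l nla].
    rewrite addr0 [RHS]mxE [delta_mx _ _ _ _]mxE [D j a]mxE eqxx /=.
    case: (eqVneq b a) => [->|nba]; first by rewrite mulr1.
    by rewrite mulr0 diagj // eq_sym.
  by rewrite mxE [delta_mx _ _ _ _]mxE eq_sym (negPf nla) mulr0.
rewrite mulmx_sumr mulmx_suml linear_sum /=; apply: eq_bigr => l _.
by rewrite rowK -scalemxAr -scalemxAl linearZ !mxE.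
Qed.

Lemma cvg_det (R : realType) (m : nat) (F : nat -> 'M[R]_m) (G : 'M[R]_m) :
  (forall a b, F k a b @[k --> \oo] --> G a b) ->
  \det (F k) @[k --> \oo] --> \det G.
Proof.
move=> FG; rewrite /determinant; apply: cvg_big => [|s _]; first exact: add_continuous.
apply: cvgMr; apply: cvg_big => [|a _]; [exact: mul_continuous|exact: FG].
Qed.

(** If [W] is a right inverse of the matrix of the family, the determinant of
    the approximating families times [W] tends to 1; it would vanish identically
    if those families, of rank at most [n], had more than [n] members. *)
Lemma ASDC_independent_leq (R : realType) (m n : nat) (A : 'I_m -> 'M[R]_n) :
  row_free (\matrix_j mxvec (A j)) -> ASDC (range A) -> (m <= n)%N.
Proof.
move=> /row_freeP[W AW1] [s [sA sdcs]]; rewrite leqNgt; apply/negP => ltnm.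
pose V i := \matrix_j mxvec (s (A j) i).
have det0 i : \det (V i *m W) = 0.
  apply/eqP; apply: contraTT ltnm; rewrite -unitfE -leqNgt => uVW.
  rewrite -(mxrank_unit uVW); apply: leq_trans (mxrankM_maxl _ _) _.
  apply: SDC_span_rank; case: (sdcs i) => P uP diagP; exists P => //.
  by move=> _ [j _ <-]; apply: diagP; exists (A j) => //; exists j.
have : \det (V i *m W) @[i --> \oo] --> \det (\matrix_j mxvec (A j) *m W).
  apply: cvg_det => a b; rewrite mxE; under eq_fun do rewrite mxE.
  apply: cvg_big => [|p _]; first exact: add_continuous.
  apply: cvgMl; rewrite mxE; under eq_fun do rewrite mxE.
  case/mxvec_indexP: p => x y; rewrite mxvecE; under eq_fun do rewrite mxvecE.
  have [_ cvgA] : (forall i, symmx (s (A a) i)) /\ s (A a) i @[i --> \oo] --> A a.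
    by apply: sA; exists a.
  exact: (cvg_comp (s (A a)) (fun M : 'M[R]_n => M x y) cvgA
            (@coord_continuous R n n x y (A a))).
rewrite AW1 det1; under eq_fun do rewrite det0.
move=> /(cvg_lim (@Rhausdorff R)); rewrite lim_cst; last exact: Rhausdorff.
by move/eqP; rewrite eq_sym oner_eq0.
Qed.

(** On a complex eigenvector for [z], the matrix [(M - a)^2] acts as
    [(z - a)^2], which forces [z = a]. *)
Lemma real_eigenvalues_double_root (R : realType) (n : nat) (M : 'M[R]_n) a :
  (M - a%:M) *m (M - a%:M) = 0 -> real_eigenvalues M.
Proof.
move=> M0 z /eigenvalueP[v vM vn0]; pose f := real_complex R.
suff /eqP : (z - f a) * (z - f a) *: v = 0.
  rewrite scaler_eq0 (negPf vn0) orbF mulf_eq0 orbb subr_eq0 => /eqP->.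
  by rewrite complex_real.
have vN : v *m map_mx f (M - a%:M) = (z - f a) *: v.
  by rewrite map_mxB map_scalar_mx mulmxBr vM mul_mx_scalar scalerBl.
by rewrite -scalerA -vN scalemxAl -vN -mulmxA -map_mxM M0 map_mx0 mulmx0.
Qed.

(** A numbering by 1, ..., 6 of the unordered pairs of indices below 3: the sum
    [x + y] only confuses [{0, 2}] with [{1, 1}], and the product term moves the
    pairs without 0 past the others.  Number 0 is kept for the block exchange. *)
Definition pair_index (x y : 'I_3) : 'I_7 :=
  inord (x + y + (0 < x) * (0 < y)).+1.

Definition sym_basis (R : realType) (k : 'I_7) : 'M[R]_3 :=
  \matrix_(x, y) (k == pair_index x y)%:R.

Definition schur_form (R : realType) (k : 'I_7) : 'M[R]_6 :=
  @block_mx R 3 3 3 3 0 (k == 0)%:R%:M (k == 0)%:R%:M (sym_basis R k).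

(** [schur_form R k] multiplied on the left by the block exchange. *)
Definition schur_quotient (R : realType) (k : 'I_7) : 'M[R]_6 :=
  @block_mx R 3 3 3 3 (k == 0)%:R%:M (sym_basis R k) 0 (k == 0)%:R%:M.

Lemma sym_basis0 (R : realType) : sym_basis R 0 = 0.
Proof.
apply/matrixP => x y; rewrite !mxE -val_eqE /= inordK //.
by case: x y => [[|[|[|//]]] ?] [[|[|[|//]]] ?].
Qed.

Lemma sym_basis_sym (R : realType) k : (sym_basis R k)^T = sym_basis R k.
Proof.
by apply/matrixP => x y; rewrite !mxE /pair_index (addnC y) (mulnC (0 < y)%N).
Qed.

Lemma schur_form_sym (R : realType) k : (schur_form R k)^T = schur_form R k.
Proof.
by rewrite [LHS](@tr_block_mx R 3 3 3 3) trmx0 !tr_scalar_mx sym_basis_sym.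
Qed.

Lemma schur_form0_mul (R : realType) k :
  schur_form R 0 *m schur_form R k = schur_quotient R k.
Proof.
rewrite [LHS](@mulmx_block R 3 3 3 3 3 3) sym_basis0.
by rewrite !(mul0mx, mul1mx, add0r, addr0).
Qed.

Lemma schur_form0_sqr (R : realType) : schur_form R 0 *m schur_form R 0 = 1%:M.
Proof. by rewrite schur_form0_mul /schur_quotient sym_basis0 -scalar_mx_block. Qed.

Lemma schur_form0_unit (R : realType) : schur_form R 0 \in unitmx.
Proof. by have [] := mulmx1_unit (schur_form0_sqr R). Qed.

Lemma invmx_schur_form0_mul (R : realType) k :
  invmx (schur_form R 0) *m schur_form R k = schur_quotient R k.
Proof.
rewrite -schur_form0_mul; congr (_ *m _); apply: esym.
rewrite -[LHS](mulKmx (schur_form0_unit R)) schur_form0_sqr.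
by rewrite mulmx1.
Qed.

Lemma schur_quotient_comm (R : realType) k l :
  comm_mx (schur_quotient R k) (schur_quotient R l).
Proof.
rewrite /comm_mx [LHS](@mulmx_block R 3 3 3 3 3 3).
rewrite [RHS](@mulmx_block R 3 3 3 3 3 3) !(mulmx0, mul0mx, add0r, addr0).
rewrite !mul_scalar_mx !mul_mx_scalar !scale_scalar_mx.
by rewrite (mulrC (k == 0)%:R) [in LHS]addrC.
Qed.

Lemma schur_quotient_real (R : realType) k :
  real_eigenvalues (schur_quotient R k).
Proof.
apply: (@real_eigenvalues_double_root _ _ _ (k == 0)%:R).
have -> : schur_quotient R k - (k == 0)%:R%:M =
    @block_mx R 3 3 3 3 0 (sym_basis R k) 0 0.
  rewrite (@scalar_mx_block R 3 3) [- _](@opp_block_mx R 3 3 3 3).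
  by rewrite [LHS](@add_block_mx R 3 3 3 3) !subrr oppr0 addr0.
rewrite [LHS](@mulmx_block R 3 3 3 3 3 3) !(mul0mx, mulmx0, add0r).
exact: (@block_mx0 R 3 3 3 3).
Qed.

Lemma pair_index_surj (k : 'I_7) : k != 0 -> exists x y, k = pair_index x y.
Proof.
move=> k0; suff [x [y e]] : exists x y : 'I_3,
    (k : nat) = (x + y + (0 < x) * (0 < y)).+1.
  by exists x, y; rewrite /pair_index -e inord_val.
case: k k0 => [[|[|[|[|[|[|[|]]]]]]] ?] //= _.
- by exists (inord 0), (inord 0); rewrite !inordK.
- by exists (inord 0), (inord 1); rewrite !inordK.
- by exists (inord 0), (inord 2); rewrite !inordK.
- by exists (inord 1), (inord 1); rewrite !inordK.
- by exists (inord 1), (inord 2); rewrite !inordK.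
- by exists (inord 2), (inord 2); rewrite !inordK.
Qed.

Lemma schur_formEur (R : realType) k (x y : 'I_3) :
  schur_form R k (lshift 3 x) (rshift 3 y) = (k == 0)%:R *+ (x == y).
Proof. by rewrite [LHS](@block_mxEur R 3 3 3 3) mxE. Qed.

Lemma schur_formEdr (R : realType) k (x y : 'I_3) :
  schur_form R k (rshift 3 x) (rshift 3 y) = (k == pair_index x y)%:R.
Proof. by rewrite [LHS](@block_mxEdr R 3 3 3 3) mxE. Qed.

(** Each coefficient of a combination of the basis is one of its entries: the
    coefficient of the block exchange on the diagonal of the upper right block,
    the others in the lower right block. *)
Lemma schur_form_free (R : realType) :
  row_free (\matrix_k mxvec (schur_form R k)).
Proof.
apply: inj_row_free => v; rewrite mulmx_sum_row => v0.
have comb0 a b : \sum_k v 0 k * schur_form R k a b = 0.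
  have -> : \sum_k v 0 k * schur_form R k a b =
      (\sum_k v 0 k *: schur_form R k) a b.
    by rewrite summxE; apply: eq_bigr => k _; rewrite [RHS]mxE.
  suff -> : \sum_k v 0 k *: schur_form R k = 0 by rewrite mxE.
  apply: (can_inj mxvecK); rewrite linear0 -[RHS]v0 linear_sum /=.
  by apply: eq_bigr => k _; rewrite linearZ rowK.
have pick (l : 'I_7) : \sum_k v 0 k * (k == l)%:R = v 0 l.
  rewrite (bigD1 l) //= eqxx mulr1 big1 ?addr0 // => k /negPf->.
  by rewrite mulr0.
apply/rowP => k; rewrite mxE.
have [->|/pair_index_surj[x [y ->]]] := eqVneq k 0; rewrite -pick.
  rewrite -[RHS](comb0 (@lshift 3 3 0) (@rshift 3 3 0)); apply: eq_bigr => l _.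
  by rewrite schur_formEur eqxx mulr1n.
rewrite -[RHS](comb0 (@rshift 3 3 x) (@rshift 3 3 y)); apply: eq_bigr => l _.
by rewrite schur_formEdr.
Qed.

Lemma schur_form_inj (R : realType) : injective (schur_form R).
Proof.
move=> k l kl; have /row_freeP[W MW1] := schur_form_free R.
have : row k (1%:M : 'M[R]_7) = row l 1%:M.
  by rewrite -MW1 !row_mul !rowK kl.
move/rowP/(_ l); rewrite !mxE eqxx.
by case: eqP => // _ /eqP; rewrite eq_sym oner_eq0.
Qed.

Theorem theorem7 (R : realType) :
  exists A : 'I_7 -> 'M[R]_6,
    let A1 := A ord0 in
    let B := [set invmx A1 *m M | M in range A] in
    injective A /\
    range A `<=` @symmx R 6 /\
    A1 \in unitmx /\
    (forall M N, B M -> B N -> comm_mx M N) /\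
    (forall M, B M -> real_eigenvalues M) /\
    ~ ASDC (range A).
Proof.
exists (schur_form R) => A1 B.
have BE M : B M -> exists k, M = schur_quotient R k.
  by case=> _ [k _ <-] <-; exists k; exact: invmx_schur_form0_mul.
split; first exact: schur_form_inj.
split; first by move=> _ [k _ <-]; exact: schur_form_sym.
split; first exact: schur_form0_unit.
split; first by move=> M N /BE[k ->] /BE[l ->]; exact: schur_quotient_comm.
split; first by move=> M /BE[k ->]; exact: schur_quotient_real.
by move=> /(ASDC_independent_leq (schur_form_free R)).
Qed.
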